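(* Let $m,n\ge2$ be integers and let $G$ be a bipartite graph with parts $[m]$ and $[n]$, with edge set identified with a subset of $[m]\times[n]$. If $G$ has an edge orientation with no directed cycles and no alternating cycles, then $G$ is independent in the dual of the matroid $\mathrm{T}_{m,n}(m-2,n-2,p)$ for every $p$ (equal to $0$ or a prime).
   Context: Write $[n]=\{1,\dots,n\}$. For integers $0\le s\le m$, $0\le r\le n$ and $p$ equal to $0$ or a prime, the tensor matroid $\mathrm{T}_{m,n}(s,r,p)$ is the following matroid on $[m]\times[n]$. Let $K$ be a field of characteristic $p$ and let $u_1,\dots,u_m\in K^s$, $v_1,\dots,v_n\in K^r$ be vectors all of whose coordinates together are algebraically independent over the prime field. A set $E\subseteq[m]\times[n]$ is independent if and only if the vectors $u_i\otimes v_j$, indexed by $(i,j)\in E$, are linearly independent in $K^s\otimes K^r$. This matroid depends only on $m,n,s,r,p$. The dual of a matroid is the matroid whose bases are the complements of its bases. Given an orientation of the edges of a graph, a directed cycle is a cycle which is consistently oriented, and an alternating cycle is a cycle whose edges alternate in orientation as one traverses the cycle. *)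

(* Defs.v *)
From mathcomp Require Import all_boot all_order all_algebra.
From mathcomp Require Import mpoly mxtens.

Set Implicit Arguments.
Unset Strict Implicit.
Unset Printing Implicit Defensive.

Import GRing.Theory.
Local Open Scope ring_scope.

(** * Matroids *)

Record matroid (T : finType) := Matroid {
  indep : {pred {set T}};
  indep_set0 : set0 \in indep;
  indep_subset : forall A B : {set T},
    A \subset B -> B \in indep -> A \in indep;
  indep_augment : forall A B : {set T},
    A \in indep -> B \in indep -> (#|A| < #|B|)%N ->
    exists2 x, x \in B :\: A & x |: A \in indep }.

Definition basis (T : finType) (M : matroid T) (B : {set T}) : bool :=
  maxset (mem (indep M)) B.

Section MatroidTheory.
Variables (T : finType) (M : matroid T).
Implicit Types A B I J : {set T}.

Lemma basis_indep B : basis M B -> B \in indep M.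
Proof. by case/maxsetP. Qed.

Lemma leq_card_basis B I : basis M B -> I \in indep M -> (#|I| <= #|B|)%N.
Proof.
move=> /maxsetP[Bi Bmax] Ii; rewrite leqNgt; apply/negP => ltBI.
have [x /setDP[_ xNB] xBi] := indep_augment Bi Ii ltBI.
by move: xNB; rewrite -(Bmax _ xBi (subsetUr _ _)) setU11.
Qed.

Lemma basisP B : reflect
  (B \in indep M /\ forall I, I \in indep M -> #|I| <= #|B|)%N (basis M B).
Proof.
apply: (iffP idP) => [bB | [Bi Bmax]].
  by split=> [|I]; [apply: basis_indep | apply: leq_card_basis].
apply/maxsetP; split=> // A Ai sBA; apply/esym/eqP.
by rewrite eqEcard sBA Bmax.
Qed.

Lemma extend_to_basis I B : I \in indep M -> basis M B ->
  exists2 B', basis M B' & (I \subset B') && (B' \subset I :|: B).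
Proof.
move=> Ii bB; have [n] := ubnP (#|B| - #|I|)%N.
elim: n => // n IHn in I Ii *; rewrite ltnS => le_n.
have [leBI|ltIB] := leqP #|B| #|I|.
  exists I; last by rewrite subxx subsetUl.
  apply/basisP; split=> // J /(leq_card_basis bB) leJB; exact: leq_trans leBI.
have [x /setDP[xB xNI] xIi] := indep_augment Ii (basis_indep bB) ltIB.
have [|B' bB' /andP[sIB' sB']] := IHn _ xIi.
  by rewrite cardsU1 xNI (leq_trans _ le_n)// ltn_sub2l.
exists B' => //; rewrite (subset_trans (subsetUr _ _) sIB') /=.
apply: subset_trans sB' _; rewrite !subUset subsetUr subsetUl.
by rewrite sub1set inE xB orbT.
Qed.

Lemma ex_basis : exists B, basis M B.
Proof.
by have [B bB _] := maxset_exists (indep_set0 M : mem (indep M) set0); exists B.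
Qed.

End MatroidTheory.

(** * Duality *)

Section Dual.
Variables (T : finType) (M : matroid T).
Implicit Types A B I J : {set T}.

Definition dual_indep : {pred {set T}} :=
  [pred I : {set T} | [exists B, basis M B && (I \subset ~: B)]].

Lemma dual_indepP I :
  reflect (exists2 B, basis M B & I \subset ~: B) (I \in dual_indep).
Proof. exact: (iffP (exists_inP (D := basis M))). Qed.

Lemma dual_indep_set0 : set0 \in dual_indep.
Proof.
by have [B bB] := ex_basis M; apply/dual_indepP; exists B; rewrite ?sub0set.
Qed.

Lemma dual_indep_subset A B :
  A \subset B -> B \in dual_indep -> A \in dual_indep.
Proof.
move=> sAB /dual_indepP[C bC sBC]; apply/dual_indepP.
by exists C => //; apply: subset_trans sBC.
Qed.

Lemma dual_indep_augment I J :
  I \in dual_indep -> J \in dual_indep -> (#|I| < #|J|)%N ->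
  exists2 x, x \in J :\: I & x |: I \in dual_indep.
Proof.
move=> /dual_indepP[BI bBI sI] /dual_indepP[BJ bBJ sJ] ltIJ.
have Di : BJ :\: I \in indep M.
  exact: indep_subset (subsetDl _ _) (basis_indep bBJ).
have [B bB /andP[sDB sBU]] := extend_to_basis Di bBI.
have sIB : I \subset ~: B.
  apply/subsetP => x xI; rewrite inE; apply/negP => /(subsetP sBU).
  by rewrite !inE xI /= => xBI; move/(subsetP sI): xI; rewrite inE xBI.
have [sJIB|/subsetPn[x xJI xNB]] := boolP (J :\: I \subset B); last first.
  exists x => //; apply/dual_indepP; exists B => //.
  by rewrite subUset sub1set inE xNB.
have leB : (#|BJ :\: I| + #|J :\: I| <= #|BJ|)%N.
  rewrite -cardsUI [X in (_ + #|pred_of_set X|)%N](_ : _ = set0).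
    rewrite cards0 addn0 (leq_trans _ (leq_card_basis bBJ (basis_indep bB)))//.
    by rewrite subset_leq_card// subUset sDB.
  apply/setP => x; rewrite !inE; apply/negP => /and3P[/andP[_ xBJ] _ xJ].
  by move/(subsetP sJ): xJ; rewrite inE xBJ.
have : (#|BJ :&: I| <= #|I :\: J|)%N.
  apply/subset_leq_card/subsetP => x; rewrite !inE => /andP[xBJ ->].
  by rewrite andbT; apply/negP => /(subsetP sJ); rewrite inE xBJ.
move: ltIJ leB; rewrite -(cardsID I BJ) -(cardsID J I) -(cardsID I J) setIC.
rewrite ltn_add2l addnC leq_add2r => lt1 le1 le2.
by have := leq_trans lt1 (leq_trans le1 le2); rewrite ltnn.
Qed.

Definition dual_matroid : matroid T :=
  Matroid dual_indep_set0 dual_indep_subset dual_indep_augment.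

Lemma basis_dual B : basis dual_matroid B = basis M (~: B).
Proof.
apply/idP/idP => [/maxsetP[/dual_indepP[C bC sBC] Bmax]|bB].
  have Ci : ~: C \in dual_indep by apply/dual_indepP; exists C.
  by rewrite -(Bmax _ Ci sBC) setCK.
apply/maxsetP; split=> [|A /dual_indepP[C bC sAC] sBA].
  by apply/dual_indepP; exists (~: B); rewrite ?setCK.
have sCB : C \subset ~: B by rewrite -setCS setCK (subset_trans sBA).
have eCB : C = ~: B.
  by apply/eqP; rewrite eqEcard sCB (leq_card_basis bC (basis_indep bB)).
by apply/eqP; rewrite eqEsubset sBA andbT -[B]setCK -eCB.
Qed.

End Dual.

(** * Linear matroids and tensor matroids *)

Section Linear.
Variables (K : fieldType) (V : vectType K) (T : finType) (f : T -> V).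
Implicit Types A B : {set T}.

Definition linear_indep : {pred {set T}} :=
  [pred E : {set T} | free [seq f e | e <- enum E]].

Lemma linear_indep_set0 : set0 \in linear_indep.
Proof. by rewrite inE enum_set0 nil_free. Qed.

Lemma linear_indep_subset A B :
  A \subset B -> B \in linear_indep -> A \in linear_indep.
Proof.
rewrite !inE => sAB.
have /perm_free -> : perm_eq [seq f e | e <- enum B]
    ([seq f e | e <- enum A] ++ [seq f e | e <- enum (B :\: A)]).
  rewrite -map_cat; apply/perm_map/uniq_perm; rewrite ?enum_uniq//.
    rewrite cat_uniq !enum_uniq andbT /=; apply/hasPn => x.
    by rewrite !mem_enum => /setDP[].
  move=> x; rewrite mem_cat !mem_enum in_setD.
  by have [/(subsetP sAB)|] := boolP (x \in A).
exact: catl_free.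
Qed.

Lemma linear_indep_augment A B :
  A \in linear_indep -> B \in linear_indep -> (#|A| < #|B|)%N ->
  exists2 x, x \in B :\: A & x |: A \in linear_indep.
Proof.
rewrite !inE => fA fB ltAB; set sA := [seq f e | e <- enum A] in fA *.
have [sub|/subsetPn[x xB xNA]] :=
    boolP (B \subset [set e | f e \in <<sA>>%VS]); last first.
  rewrite inE in xNA; have xA : x \notin A.
    by apply: contra xNA => xA; rewrite memv_span// map_f// mem_enum.
  exists x; first by rewrite inE xA.
  rewrite inE (@perm_free _ _ _ (f x :: sA)) ?free_cons ?xNA//.
  rewrite -map_cons; apply/perm_map/uniq_perm; rewrite /= ?enum_uniq//.
    by rewrite mem_enum xA.
  by move=> y; rewrite inE !mem_enum !inE.
have : (<<[seq f e | e <- enum B]>> <= <<sA>>)%VS.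
  apply/span_subvP => _ /mapP[e + ->]; rewrite mem_enum => /(subsetP sub).
  by rewrite inE.
move/dimvS; rewrite (eqnP fA) (eqnP fB) !size_map -!cardE.
by rewrite leqNgt ltAB.
Qed.

Definition linear_matroid : matroid T :=
  Matroid linear_indep_set0 linear_indep_subset linear_indep_augment.

End Linear.

Definition has_characteristic (R : nzRingType) (p : nat) : Prop :=
  if p == 0%N then [pchar R] =i pred0 else p \in [pchar R].

Definition in_prime_field (K : fieldType) (x : K) : Prop :=
  exists a b : int, x = a%:~R / b%:~R.

Definition algebraically_independent (K : fieldType) (k : nat)
    (x : 'I_k -> K) : Prop :=
  forall P : {mpoly K[k]},
    (forall mon, in_prime_field P@_mon) -> P.@[x] = 0 -> P = 0.

(* All the coordinates of the rows of u and of the rows of v, taken together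
   as a single family, are algebraically independent. *)
Definition generic_vectors (K : fieldType) (m n s r : nat)
    (u : 'M[K]_(m, s)) (v : 'M[K]_(n, r)) : Prop :=
  algebraically_independent (fun k => row_mx (mxvec u) (mxvec v) 0 k).

(* The vectors u_i and v_j are the rows of u and v; K^s (x) K^r is identified
   with K^(s * r) by the Kronecker product. *)
Definition tensor_vector (K : fieldType) (m n s r : nat)
    (u : 'M[K]_(m, s)) (v : 'M[K]_(n, r)) (e : 'I_m * 'I_n) :
    'M[K]_(1 * 1, s * r) :=
  row e.1 u *t row e.2 v.

(* M is the matroid T_(m,n)(s,r,p). *)
Definition is_tensor_matroid (m n s r p : nat)
    (M : matroid ('I_m * 'I_n)%type) : Prop :=
  exists (K : fieldType) (u : 'M[K]_(m, s)) (v : 'M[K]_(n, r)),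
    [/\ has_characteristic K p, generic_vectors u v &
        indep M =i indep (linear_matroid (tensor_vector u v))].

(** * Orientations of graphs *)

Definition bipartite_graph (m n : nat) (G : {set 'I_m * 'I_n}) :
    rel ('I_m + 'I_n) :=
  fun x y => match x, y with
  | inl i, inr j | inr j, inl i => (i, j) \in G
  | _, _ => false
  end.

Section Orientation.
Variables (V : finType) (e A : rel V).

(* A x y means that the edge {x, y} is oriented from x to y. *)
Definition orientation : Prop :=
  (forall x y, e x y = A x y || A y x) /\ (forall x y, A x y -> ~~ A y x).

Definition graph_cycle (c : seq V) : bool :=
  ucycleb e c && (2 < size c)%N.

Definition directed_cycle (c : seq V) : bool :=
  graph_cycle c && cycle A c.

(* At each vertex x of c, exactly one of the two consecutive edges
   (prev c x, x) and (x, next c x) is oriented in the direction of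
   traversal. *)
Definition alternating_cycle (c : seq V) : bool :=
  graph_cycle c && all (fun x => A (prev c x) x (+) A x (next c x)) c.

End Orientation.

(* Main.v *)
Require Import Defs.
From mathcomp Require Import all_boot all_order all_algebra.
From mathcomp Require Import mpoly mxtens.

(* G is independent in the dual matroid as soon as, for some vectors U_i, V_j
   over an extension of K, the tensors U_i (x) V_j with (i, j) outside G span:
   a minor that is nonzero at a special point is a nonzero polynomial over the
   prime field, hence nonzero at a generic point.  Put x_i = (1, z^(w i)) and
   y_j = (1, z^(w j)), where w is a height which decreases along the arcs of
   the acyclic orientation, and let the columns of U and V span the linear
   relations among the x_i and among the y_j.  If the tensors fail to span,
   some nonzero matrix N = U X V^T is supported on G; its rows are relations
   among the y_j and its columns relations among the x_i.  At z = 0, the matrix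
   M_ij = N_ij z^(min (w i) (w j)) splits into two matrices, supported on the
   edges directed from left to right and from right to left, all of whose row
   and column sums vanish.  In a bipartite graph an alternating cycle is one
   whose edges all point to the same side, so both edge sets are forests and
   these matrices are zero.  Hence z divides M, and infinite descent gives
   M = 0. *)

Set Implicit Arguments.
Unset Strict Implicit.
Unset Printing Implicit Defensive.

Import GRing.Theory.
Local Open Scope ring_scope.

(** * Cycles and heights in finite graphs *)

Section Graphs.
Variable V : finType.
Implicit Types (g e A : rel V) (c p : seq V).

(* Extend a simple path backwards from its head [y] for as long as possible:
   the extra neighbour of [y] must eventually lie on the path. *)
Lemma ex_graph_cycle g x y :
    ssrbool.symmetric g -> irreflexive g ->
    (forall x y, g x y -> exists2 z, z != x & g y z) -> g x y ->
  exists c, graph_cycle g c.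
Proof.
move=> g_sym g_irr g_deg gxy.
suff path_or_cycle k : (exists c, graph_cycle g c) \/
    exists a b q, [/\ size q = k, path g b (a :: q) & uniq (b :: a :: q)].
  have [//|[a [b [q [sz_q _ /card_uniqP card_q]]]]] := path_or_cycle #|V|.
  have := max_card (mem (b :: a :: q)); rewrite card_q /= sz_q.
  by rewrite ltnNge leqnSn.
elim: k => [|k [|[a [b [q [<- gq uq]]]]]]; [|by left|].
  right; exists x, y, [::]; rewrite /= g_sym gxy mem_seq1 !andbT; split=> //.
  by apply: contraTneq gxy => ->; rewrite g_irr.
have gab : g a b by case/andP: gq => gba _; rewrite g_sym.
have [z zNa gbz] := g_deg _ _ gab.
have zNb : z != b by apply: contraTneq gbz => ->; rewrite g_irr.
have [zq|zNq] := boolP (z \in q); last first.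
  right; exists b, z, (a :: q); split=> //; first by rewrite /= g_sym gbz.
  by rewrite cons_uniq uq andbT !inE !negb_or zNb zNa.
left; move: gq uq; case/path.splitP: zq => q1 q2 gq uq.
exists (b :: a :: rcons q1 z); rewrite /graph_cycle /ucycleb -andbA.
apply/and3P; split.
- move: gq; rewrite -cat_cons cat_path => /andP[gq _].
  by rewrite /cycle rcons_path gq /= last_rcons g_sym.
- by move: uq; rewrite -!cat_cons cat_uniq => /andP[].
- by rewrite /= size_rcons.
Qed.

(** The height counts the vertices reachable from [x]. It drops strictly along an arc, since a path
    from [y] back to [x] would close up into a directed cycle. *)
Lemma ex_topological_height e A :
    orientation e A -> (forall c, ~~ directed_cycle e A c) ->
  exists w : V -> nat, forall x y, A x y -> (w y < w x)%N.
Proof.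
move=> [eA asymA] acycA; exists (fun x => #|[set y | connect A x y]|).
move=> x y Axy.
apply/proper_card/properP; split.
  apply/subsetP => z; rewrite !inE; apply: connect_trans; exact: connect1.
exists x; rewrite !inE ?connect0//; apply/connectP => -[p Ap lastp].
move: lastp; have [q Aq uq _] := shortenP Ap => lastq.
have /negP[] := acycA (y :: q); rewrite /directed_cycle /graph_cycle /ucycleb.
have cycA : cycle A (y :: q) by rewrite /= rcons_path Aq /= -lastq.
rewrite cycA uq (sub_cycle _ cycA) => [|a b]; last by rewrite eA => ->.
(* A [graph_cycle] has at least three vertices, so loops and two-cycles are excluded by the
   asymmetry of [A] instead. *)
case: q {uq cycA} => [|a [|b q]] in Aq lastq * => //; move: lastq Axy => /= ->.
  by move/[dup]/asymA/negbTE->.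
by case/andP: Aq => Aya _ /asymA; rewrite Aya.
Qed.

End Graphs.

(** * Forests and monochromatic edge sets *)

Section ZeroSums.
Variables (R : zmodType) (m n : nat).

(** A zero sum never has exactly one nonzero term, so in the graph of the support every edge can be
    continued at both ends; such a graph has a cycle unless it is empty. *)
Lemma zero_sum_forest (S : {set 'I_m * 'I_n}) (f : 'I_m -> 'I_n -> R) :
    (forall c, ~~ graph_cycle (bipartite_graph S) c) ->
    (forall i j, (i, j) \notin S -> f i j = 0) ->
    (forall i, \sum_j f i j = 0) -> (forall j, \sum_i f i j = 0) ->
  forall i j, f i j = 0.
Proof.
move=> acyc f0 rowf colf i j; apply/eqP/negPn/negP => fij.
pose g := bipartite_graph [set e | f e.1 e.2 != 0].
have sub_g : subrel g (bipartite_graph S).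
  have fS a b : f a b != 0 -> (a, b) \in S by apply: contraNT => /f0->.
  by move=> [a|b] [a'|b'] //=; rewrite inE => /fS.
have ex_other (I : finType) (h : I -> R) a :
    \sum_k h k = 0 -> h a != 0 -> exists2 b, b != a & h b != 0.
  rewrite (bigD1 a) //= => sum0 ha; apply/exists_inP; apply: contraNT ha.
  rewrite negb_exists_in => /forall_inP h0; rewrite -sum0 big1 ?addr0// => b.
  by move/h0; rewrite negbK => /eqP.
have [||x y||c /andP[/andP[cyc_c uniq_c] size_c]] :=
    @ex_graph_cycle _ g (inl i) (inr j).
- by move=> [?|?] [?|?].
- by case.
- case: x y => [a|b] [a'|b'] //=; rewrite inE /= => fab.
    by have [k kNa fk] := ex_other _ _ _ (colf b') fab; exists (inl k);
      rewrite //= inE.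
  by have [k kNa fk] := ex_other _ _ _ (rowf a') fab; exists (inr k);
      rewrite //= inE.
- by rewrite /= inE.
have /negP[] := acyc c.
by rewrite /graph_cycle /ucycleb (sub_cycle sub_g cyc_c) uniq_c.
Qed.

End ZeroSums.

Section Monochromatic.
Variables (m n : nat) (G S : {set 'I_m * 'I_n}) (A : rel ('I_m + 'I_n)%type).
Hypotheses (oriA : orientation (bipartite_graph G) A).
Hypothesis altA : forall c, ~~ alternating_cycle (bipartite_graph G) A c.

(** All edges of [S] point to the same side, while a traversal switches sides at each step and so
    meets them alternately forwards and backwards: a cycle in [S] would be alternating. *)
Lemma monochromatic_acyclic b :
    (forall i j, (i, j) \in S -> (i, j) \in G /\ A (inl i) (inr j) = b) ->
  forall c, ~~ graph_cycle (bipartite_graph S) c.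
Proof.
case: oriA => eA asymA SG c; apply/negP => /andP[/andP[cycS uniq_c] size_c].
have side x y : bipartite_graph S x y -> bipartite_graph G x y /\
    A x y = (if x is inl _ then b else ~~ b) /\
    (if x is inl _ then true else false) =
      ~~ (if y is inl _ then true else false).
  case: x y => [i|j] [i'|j'] //= /SG[Gij Aij]; split=> //; split=> //.
  have := eA (inl i') (inr j); rewrite /= Gij Aij.
  by case: (b) Aij => [/asymA/negbTE|_ /= <-].
have /negP[] := altA c; rewrite /alternating_cycle /graph_cycle /ucycleb.
rewrite uniq_c size_c (sub_cycle _ cycS) => [/=|x y /side[]//].
apply/allP => x xc; have [_ [-> +]] := side _ _ (prev_cycle cycS xc).
have [_ [-> _]] := side _ _ (next_cycle cycS xc).
by case: (prev c x); case: (x) => ? ? //= _; case: (b).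
Qed.

End Monochromatic.

(** * Degeneration at ['X = 0] *)

Lemma minn_addB k l : (minn k l + (l - k) = l)%N.
Proof.
have [/subnKC//|/ltnW] := leqP k l; rewrite -subn_eq0 => /eqP->.
by rewrite addn0.
Qed.

Section Degeneration.
Variables (K : fieldType) (m n : nat) (G : {set 'I_m * 'I_n}).
Variables (a : 'I_m -> nat) (b : 'I_n -> nat).
Hypothesis ab_neq : forall i j, (i, j) \in G -> a i != b j.
Hypothesis acyc_gt : forall c,
  ~~ graph_cycle (bipartite_graph [set e in G | b e.2 < a e.1]%N) c.
Hypothesis acyc_lt : forall c,
  ~~ graph_cycle (bipartite_graph [set e in G | a e.1 < b e.2]%N) c.

(* Since subtraction is truncated, the exponent [b j - a i] vanishes
   exactly when [b j <= a i]: at ['X = 0] only one class of edges survives in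
   each sum. *)
Lemma poly_zero_sum (M : 'I_m -> 'I_n -> {poly K}) :
    (forall i j, (i, j) \notin G -> M i j = 0) ->
    (forall i, \sum_j M i j * 'X^(b j - a i) = 0) ->
    (forall j, \sum_i M i j * 'X^(b j - a i) = 0) ->
    (forall i, \sum_j M i j * 'X^(a i - b j) = 0) ->
    (forall j, \sum_i M i j * 'X^(a i - b j) = 0) ->
  forall i j, M i j = 0.
Proof.
move=> MG row_gt col_gt row_lt col_lt.
have [k] : exists k, forall i j, (size (M i j) <= k)%N.
  exists (\max_i \max_j size (M i j))%N => i j.
  by apply: leq_trans (leq_bigmax i); apply: (leq_bigmax (F := fun j => _)).
elim: k => [|k IHk] in M MG row_gt col_gt row_lt col_lt * => leMk.
  by move=> i j; apply/eqP; rewrite -size_poly_leq0.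
have coef0_sum (I : finType) (f : I -> {poly K}) (d : I -> nat) :
    \sum_i f i * 'X^(d i) = 0 -> \sum_i (f i)`_0 * (d i == 0)%N%:R = 0.
  move/(congr1 (fun p : {poly K} => p`_0)); rewrite coef_sum coef0 => sum0.
  rewrite -[RHS]sum0.
  by apply: eq_bigr => i _; rewrite coef0M coefXn eq_sym.
(* Ties are excluded by [ab_neq]: off the chosen edges, either the entry of [M] is zero or the
   exponent is positive. *)
have off_gt i j : (i, j) \notin [set e in G | b e.2 < a e.1]%N ->
    (M i j)`_0 * (b j - a i == 0)%N%:R = 0.
  have [ijG|/MG->] := boolP ((i, j) \in G); last by rewrite coef0 mul0r.
  rewrite inE ijG => /negbTE /= gtF.
  by rewrite subn_eq0 leq_eqVlt eq_sym (negbTE (ab_neq ijG)) gtF mulr0.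
have off_lt i j : (i, j) \notin [set e in G | a e.1 < b e.2]%N ->
    (M i j)`_0 * (a i - b j == 0)%N%:R = 0.
  have [ijG|/MG->] := boolP ((i, j) \in G); last by rewrite coef0 mul0r.
  rewrite inE ijG => /negbTE /= ltF.
  by rewrite subn_eq0 leq_eqVlt (negbTE (ab_neq ijG)) ltF mulr0.
have M0 i j : (M i j)`_0 = 0.
  have [leba|/ltnW leab] := leqP (b j) (a i).
    have := zero_sum_forest acyc_gt off_gt (fun i => coef0_sum _ _ _ (row_gt i))
      (fun j => coef0_sum _ _ _ (col_gt j)) i j.
    by rewrite (eqP leba) mulr1.
  have := zero_sum_forest acyc_lt off_lt (fun i => coef0_sum _ _ _ (row_lt i))
    (fun j => coef0_sum _ _ _ (col_lt j)) i j.
  by rewrite (eqP leab) mulr1.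
(* All entries are now divisible by ['X]; the quotients satisfy the same equations with a smaller
   size bound. *)
pose M' i j := drop_poly 1 (M i j).
have defM i j : M i j = M' i j * 'X.
  rewrite -[LHS](poly_take_drop 1) expr1 [take_poly _ _](_ : _ = 0) ?add0r//.
  by apply/polyP => -[|l]; rewrite coef_take_poly coef0 //= M0.
have divX (I : finType) (f f' : I -> {poly K}) (d : I -> nat) :
    (forall i, f i = f' i * 'X) ->
    \sum_i f i * 'X^(d i) = 0 -> \sum_i f' i * 'X^(d i) = 0.
  move=> ff' f0; apply: (@mulIf _ (polyX K)).
    by rewrite polyX_eq0.
  rewrite mul0r -[RHS]f0.
  by rewrite mulr_suml; apply: eq_bigr => i _; rewrite ff' mulrAC.
move=> i j; rewrite defM (IHk M') ?mul0r// => {i j}.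
- by move=> i j /MG Mij; rewrite /M' drop_poly_eq0 ?Mij ?size_poly0.
- by move=> i; apply: divX (row_gt i).
- by move=> j; apply: divX (col_gt j).
- by move=> i; apply: divX (row_lt i).
- by move=> j; apply: divX (col_lt j).
by move=> i j; rewrite size_drop_poly leq_subLR add1n.
Qed.

(** The twist by the minimum turns the four sums of [poly_zero_sum] into sums of [N] weighted by
    ['X^(b j)] or ['X^(a i)]. Two of them are hypotheses; in the other two the weight is constant
    and factors out. *)
Lemma poly_kernel_eq0 (N : 'I_m -> 'I_n -> {poly K}) :
    (forall i j, (i, j) \notin G -> N i j = 0) ->
    (forall i, \sum_j N i j = 0) -> (forall i, \sum_j N i j * 'X^(b j) = 0) ->
    (forall j, \sum_i N i j = 0) -> (forall j, \sum_i N i j * 'X^(a i) = 0) ->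
  forall i j, N i j = 0.
Proof.
move=> NG row1 rowX col1 colX.
pose M i j := N i j * 'X^(minn (a i) (b j)).
have M_gt i j : M i j * 'X^(b j - a i) = N i j * 'X^(b j).
  by rewrite -mulrA -exprD minn_addB.
have M_lt i j : M i j * 'X^(a i - b j) = N i j * 'X^(a i).
  by rewrite -mulrA -exprD minnC minn_addB.
suff M0 i j : M i j = 0.
  move=> i j; apply/eqP; have /eqP := M0 i j.
  by rewrite mulf_eq0 expf_eq0 polyX_eq0 andbF orbF.
apply: poly_zero_sum => {i j} [i j /NG Nij|i|j|i|j].
- by rewrite /M Nij mul0r.
- by under eq_bigr do rewrite M_gt.
- by under eq_bigr do rewrite M_gt; rewrite -mulr_suml col1 mul0r.
- by under eq_bigr do rewrite M_lt; rewrite -mulr_suml row1 mul0r.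
- by under eq_bigr do rewrite M_lt.
Qed.

End Degeneration.

(** * Clearing denominators *)

Section Fractions.
Variable R : idomainType.
Local Notation tofrac := (@FracField.tofrac R).

Lemma frac_denominator (x : {fraction R}) :
  exists2 d : R, d != 0 & exists y : R, x * tofrac d = tofrac y.
Proof.
elim/quotW: x => r; exists r.2; first exact: denom_ratioP.
exists r.1; unlock FracField.tofrac; rewrite -[LHS]FracField.pi_mul.
apply/eqmodP; rewrite /= FracField.equivfE /FracField.mulf /=.
by rewrite !numden_Ratio ?mulr1 ?oner_eq0 ?denom_ratioP// mulrC.
Qed.

Lemma common_denominator (I : finType) (f : I -> {fraction R}) :
  exists2 d : R, d != 0 &
    exists g : I -> R, forall i, f i * tofrac d = tofrac (g i).
Proof.
have den i : exists dy : R * R, dy.1 != 0 /\ f i * tofrac dy.1 = tofrac dy.2.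
  by have [d d0 [y dy]] := frac_denominator (f i); exists (d, y).
have [dy dyP] := fin_all_exists den.
exists (\prod_i (dy i).1); first by apply/prodf_neq0 => i _; case: (dyP i).
exists (fun i => (dy i).2 * \prod_(j | j != i) (dy j).1) => i.
by rewrite (bigD1 i) //= !rmorphM mulrA; case: (dyP i) => _ ->.
Qed.

End Fractions.

(** * Special tensors over the field of rational functions *)

Lemma ex_row_free_kernel (F : fieldType) (m k : nat) (A : 'M[F]_(m, k)) :
  exists2 W : 'M[F]_(m - k, m), row_free W & W *m A = 0.
Proof.
have le_mk : (m - k <= \rank (kermx A))%N.
  by rewrite mxrank_ker leq_sub2l// rank_leq_col.
(* The kernel may have dimension above [m - k]; [pid_mx] keeps the first [m - k] vectors of a
   basis. *)
exists (pid_mx (m - k) *m row_base (kermx A)).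
  by rewrite /row_free mxrankMfree ?row_base_free// rank_pid_mx.
have /sub_kermxP kerW : (row_base (kermx A) <= kermx A)%MS.
  by rewrite eq_row_base.
by rewrite -mulmxA kerW mulmx0.
Qed.

Definition tensor_matrix (R : pzRingType) (m n s r k : nat)
    (u : 'M[R]_(m, s)) (v : 'M[R]_(n, r)) (f : 'I_k -> 'I_m * 'I_n) :
    'M[R]_(k, s * r) :=
  \matrix_(i, l) (u (f i).1 (mxtens_unindex l).1 *
                  v (f i).2 (mxtens_unindex l).2).

Lemma map_tensor_matrix (R S : pzRingType) (h : {rmorphism R -> S})
    (m n s r k : nat) (u : 'M[R]_(m, s)) (v : 'M[R]_(n, r))
    (f : 'I_k -> 'I_m * 'I_n) :
  map_mx h (tensor_matrix u v f) = tensor_matrix (map_mx h u) (map_mx h v) f.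
Proof. by apply/matrixP => i l; rewrite !mxE rmorphM. Qed.

Section Specialization.
Variables (K : fieldType) (m n : nat) (G : {set 'I_m * 'I_n}).
Variables (a : 'I_m -> nat) (b : 'I_n -> nat).
Hypothesis ab_neq : forall i j, (i, j) \in G -> a i != b j.
Hypothesis acyc_gt : forall c,
  ~~ graph_cycle (bipartite_graph [set e in G | b e.2 < a e.1]%N) c.
Hypothesis acyc_lt : forall c,
  ~~ graph_cycle (bipartite_graph [set e in G | a e.1 < b e.2]%N) c.

Local Notation L := {fraction {poly K}}.
Local Notation tofrac := (@FracField.tofrac {poly K}).

Definition monomial_points k (c : 'I_k -> nat) : 'M[L]_(k, 2) :=
  \matrix_(i, l) tofrac 'X^(l * c i).

(** Column [0] of [monomial_points] holds ones and column [1] the monomials, so the two matrix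
    equations become, over a common denominator, the four sums of [poly_kernel_eq0]. *)
Lemma monomial_kernel_eq0 (N : 'M[L]_(m, n)) :
    (forall i j, (i, j) \notin G -> N i j = 0) ->
    N *m monomial_points b = 0 -> N^T *m monomial_points a = 0 -> N = 0.
Proof.
move=> NG Nb Na.
have [d d0 [g gE]] := common_denominator (fun e : 'I_m * 'I_n => N e.1 e.2).
have rowN i (l : 'I_2) : \sum_j g (i, j) * 'X^(l * b j) = 0.
  apply/eqP; rewrite -tofrac_eq0; apply/eqP.
  have /matrixP/(_ i l) := Nb; rewrite !mxE => Nbil.
  rewrite -(mul0r (tofrac d)) -Nbil mulr_suml rmorph_sum; apply: eq_bigr => j _.
  by rewrite /= tofracM -gE !mxE mulrAC.
have colN j (l : 'I_2) : \sum_i g (i, j) * 'X^(l * a i) = 0.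
  apply/eqP; rewrite -tofrac_eq0; apply/eqP.
  have /matrixP/(_ j l) := Na; rewrite !mxE => Najl.
  rewrite -(mul0r (tofrac d)) -Najl mulr_suml rmorph_sum; apply: eq_bigr => i _.
  by rewrite /= tofracM -gE !mxE mulrAC.
have g0 i j : g (i, j) = 0.
  apply: (poly_kernel_eq0 ab_neq acyc_gt acyc_lt
           (N := fun i j => g (i, j))) => {i j} [i j /NG Nij|i|i|j|j].
  - by apply/eqP; rewrite -tofrac_eq0 -gE Nij mul0r.
  - by rewrite -[RHS](rowN i 0); apply: eq_bigr => j _; rewrite mul0n mulr1.
  - by rewrite -[RHS](rowN i 1); apply: eq_bigr => j _; rewrite mul1n.
  - by rewrite -[RHS](colN j 0); apply: eq_bigr => i _; rewrite mul0n mulr1.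
  - by rewrite -[RHS](colN j 1); apply: eq_bigr => i _; rewrite mul1n.
apply/matrixP => i j; rewrite mxE; apply/eqP.
have /eqP := gE (i, j); rewrite g0 rmorph0 mulf_eq0 tofrac_eq0 (negbTE d0).
by rewrite orbF.
Qed.

Lemma ex_spanning_tensors :
  exists (u : 'M[L]_(m, m - 2)) (v : 'M[L]_(n, n - 2))
         (f : 'I_((m - 2) * (n - 2)) -> 'I_m * 'I_n),
    [/\ injective f, forall k, f k \notin G & \det (tensor_matrix u v f) != 0].
Proof.
have [W W_free WP] := ex_row_free_kernel (monomial_points a).
have [Z Z_free ZQ] := ex_row_free_kernel (monomial_points b).
(* Zero rows at the pairs in [G] force any nonsingular choice of rows to avoid [G]. *)
pose Y : 'M[L]_(m * n, (m - 2) * (n - 2)) := \matrix_(k, l)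
  if mxtens_unindex k \in G then 0 else
  W (mxtens_unindex l).1 (mxtens_unindex k).1 *
  Z (mxtens_unindex l).2 (mxtens_unindex k).2.
have Y_full : row_full Y.
  rewrite /row_full -mxrank_tr; apply: inj_row_free => x xY.
  (* A relation among the columns of [Y], reshaped as [X], makes [W^T *m X *m Z] vanish outside
     [G]. *)
  pose X : 'M[L]_(m - 2, n - 2) := \matrix_(c, d) x 0 (mxtens_index (c, d)).
  have WXZ i j : (W^T *m X *m Z) i j =
      \sum_l x 0 l * (W (mxtens_unindex l).1 i * Z (mxtens_unindex l).2 j).
    rewrite mxE; under eq_bigr do rewrite mxE mulr_suml.
    rewrite exchange_big pair_big.
    rewrite [RHS](reindex (@mxtens_index _ _)); last first.
      by exists (@mxtens_unindex _ _) => ? _;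
        rewrite ?mxtens_indexK ?mxtens_unindexK.
    apply: eq_big => [//|[c d] _]; rewrite mxtens_indexK !mxE.
    by rewrite -mulrA mulrCA.
  have X0 : W^T *m X *m Z = 0.
    apply: monomial_kernel_eq0 => [i j ijNG||].
    - rewrite WXZ; have /matrixP/(_ 0 (mxtens_index (i, j))) := xY.
      rewrite !mxE => xYij; rewrite -[RHS]xYij; apply: eq_bigr => l _.
      by rewrite !mxE mxtens_indexK (negbTE ijNG).
    - by rewrite -!mulmxA ZQ !mulmx0.
    - by rewrite !trmx_mul trmxK -!mulmxA WP !mulmx0.
  have {}X0 : X = 0.
    apply/trmx_inj/(row_free_inj W_free); apply/trmx_inj/(row_free_inj Z_free).
    by rewrite trmx_mul trmxK X0 trmx0 !mul0mx trmx0 mul0mx.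
  apply/rowP => l; pose cd := mxtens_unindex l.
  have /matrixP/(_ cd.1 cd.2) := X0.
  by rewrite !mxE -surjective_pairing mxtens_unindexK.
pose g := fullrankfun Y_full; pose f k := mxtens_unindex (g k).
have detY : \det (rowsub g Y) != 0.
  by rewrite -unitfE -unitmxE fullrowsub_unit.
have fNG k : f k \notin G.
  apply: contra detY => fkG; rewrite (expand_det_row _ k) big1// => l _.
  by rewrite !mxE fkG mul0r.
have defY : rowsub g Y = tensor_matrix W^T Z^T f.
  by apply/matrixP => k l; rewrite !mxE (negbTE (fNG k)).
exists W^T, Z^T, f; split; [|exact: fNG|by rewrite -defY].
by move=> k l /(can_inj (@mxtens_unindexK _ _))/fullrankfun_inj.
Qed.

End Specialization.

(** * Transfer from a special point to generic vectors *)

Section Transfer.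
Variables (m n s r : nat).
Local Notation k := (m * s + n * r)%N.

(** Variables are numbered like the entries of [row_mx (mxvec u) (mxvec v)], so that evaluation
    there gives back [u]. *)
Definition left_vars (R : nzRingType) : 'M[{mpoly R[k]}]_(m, s) :=
  \matrix_(i, a) 'X_(lshift _ (mxvec_index i a)).

Definition right_vars (R : nzRingType) : 'M[{mpoly R[k]}]_(n, r) :=
  \matrix_(j, b) 'X_(rshift _ (mxvec_index j b)).

Lemma mmap_det_vars (R : comNzRingType) (S : comNzRingType)
    (h : {rmorphism R -> S}) (u : 'M[S]_(m, s)) (v : 'M[S]_(n, r)) f :
  mmap h (fun l => row_mx (mxvec u) (mxvec v) 0 l)
    (\det (tensor_matrix (left_vars R) (right_vars R) f)) =
  \det (tensor_matrix u v f).
Proof.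
rewrite -det_map_mx map_tensor_matrix; congr (\det (tensor_matrix _ _ _)).
  by apply/matrixP => i a; rewrite !mxE /= mmapX mmap1U row_mxEl mxvecE.
by apply/matrixP => i a; rewrite !mxE /= mmapX mmap1U row_mxEr mxvecE.
Qed.

(** The determinant in the variables has integer coefficients. If it vanished at [u] and [v],
    genericity would make it the zero polynomial over [K], hence zero at [U] and [V] through [h]. *)
Lemma generic_det_neq0 (K L : fieldType) (h : {rmorphism K -> L})
    (u : 'M[K]_(m, s)) (v : 'M[K]_(n, r))
    (U : 'M[L]_(m, s)) (V : 'M[L]_(n, r)) f :
  generic_vectors u v ->
  \det (tensor_matrix U V f) != 0 -> \det (tensor_matrix u v f) != 0.
Proof.
move=> gen; apply: contra => /eqP det0.
pose P R := \det (tensor_matrix (left_vars R) (right_vars R) f).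
have PK : P K = map_mpoly intr (P int).
  rewrite -det_map_mx map_tensor_matrix; congr (\det (tensor_matrix _ _ _)).
    by apply/matrixP => i a; rewrite !mxE /= map_mpolyX.
  by apply/matrixP => i a; rewrite !mxE /= map_mpolyX.
have P0 : P K = 0.
  apply: gen => [mon|]; last by rewrite [LHS](mmap_det_vars idfun) det0.
  by exists (P int)@_mon, 1; rewrite PK mcoeff_map_mpoly divr1.
by rewrite -(mmap_det_vars h) -[\det _]/(P K) P0 rmorph0.
Qed.

End Transfer.

(** * Bases of the tensor matroid and the conclusion *)

Section TensorMatroid.
Variables (K : fieldType) (m n s r : nat).
Variables (u : 'M[K]_(m, s)) (v : 'M[K]_(n, r)).

(** A nonzero determinant gives [s * r] independent tensors, and [s * r] is the dimension of the
    ambient space. *)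
Lemma tensor_basis (T : matroid ('I_m * 'I_n)%type)
    (f : 'I_(s * r) -> 'I_m * 'I_n) :
    indep T =i indep (linear_matroid (tensor_vector u v)) ->
    injective f -> \det (tensor_matrix u v f) != 0 ->
  Defs.basis T (f @: setT).
Proof.
move=> defT f_inj det_f; pose t l := tensor_vector u v (f l).
have perm_f : perm_eq [seq tensor_vector u v e | e <- enum (f @: setT)]
    (mktuple t).
  rewrite [tval _](map_comp (tensor_vector u v) f) /=.
  apply/perm_map/uniq_perm.
  - exact: enum_uniq.
  - by rewrite map_inj_uniq ?enum_uniq.
  move=> e; rewrite mem_enum; apply/imsetP/mapP => -[l _ ->]; exists l => //.
  by rewrite mem_enum.
apply/basisP; split=> [|I].
  rewrite defT inE (perm_free perm_f); apply/freeP => c c0.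
  have /row_free_inj : row_free (tensor_matrix u v f).
    by rewrite row_free_unit unitmxE unitfE.
  move=> /(_ _ (\row_l c l) 0); rewrite mul0mx => row0.
  suff /row0 c_eq0 : \row_l c l *m tensor_matrix u v f = 0.
    by move=> l; have /matrixP/(_ 0 l) := c_eq0; rewrite !mxE.
  apply/rowP => q; have /matrixP/(_ 0 q) := c0; rewrite !mxE summxE => sum0.
  rewrite -[RHS]sum0; apply: eq_bigr => l _.
  by rewrite (nth_map l) ?size_enum_ord// nth_ord_enum !mxE.
rewrite defT inE cardE => /eqnP; rewrite size_map => <-.
rewrite card_imset// cardsT card_ord -[leqRHS]mul1n.
by rewrite (leq_trans (dimvS (subvf _)))// dimvf dim_matrix.
Qed.

End TensorMatroid.

Local Close Scope ring_scope.

Theorem proposition4p2 (m n : nat) (hm : 2 <= m) (hn : 2 <= n)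
    (G : {set 'I_m * 'I_n})
    (hG : exists A : rel ('I_m + 'I_n)%type,
        [/\ orientation (bipartite_graph G) A,
            forall c, ~~ directed_cycle (bipartite_graph G) A c &
            forall c, ~~ alternating_cycle (bipartite_graph G) A c])
    (p : nat) (hp : p = 0 \/ prime p)
    (T : matroid ('I_m * 'I_n)%type)
    (hT : is_tensor_matroid (m - 2) (n - 2) p T) :
  G \in indep (dual_matroid T).
Proof.
have [A [oriA dirA altA]] := hG; have [K [u [v [_ gen defT]]]] := hT.
have [w wA] := ex_topological_height oriA dirA.
have edgeA i j : (i, j) \in G -> A (inl i) (inr j) || A (inr j) (inl i).
  by case: oriA => /(_ (inl i) (inr j)) /= ->.
have mono b (S : {set 'I_m * 'I_n}) :
    (forall i j, (i, j) \in S -> (i, j) \in G /\ A (inl i) (inr j) = b) ->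
    forall c, ~~ graph_cycle (bipartite_graph S) c.
  exact: monochromatic_acyclic.
(* The heights of the two sides serve as exponents; on an edge of [G], comparing them recovers its
   direction. *)
have [|||U [V [f [f_inj fNG det_f]]]] :=
    @ex_spanning_tensors K m n G (w \o inl) (w \o inr).
- move=> i j /edgeA/orP[]/wA; first by rewrite neq_ltn orbC => ->.
  by rewrite neq_ltn => ->.
- apply: (mono true) => i j; rewrite inE => /andP[ijG /= lt_ji]; split=> //.
  by have /orP[//|/wA] := edgeA _ _ ijG; rewrite ltnNge ltnW.
- apply: (mono false) => i j; rewrite inE => /andP[ijG /= lt_ij]; split=> //.
  by apply: contraTF lt_ij => /wA lt_ji; rewrite -leqNgt ltnW.
(* [K] embeds as constants in the rational functions, so the special determinant makes the generic
   one nonzero. *)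
apply/dual_indepP; exists (f @: setT).
  apply: tensor_basis defT f_inj _.
  exact: (generic_det_neq0 (@FracField.tofrac {poly K} \o polyC) gen det_f).
apply/subsetP => e eG; rewrite inE; apply: contraTN eG => /imsetP[l _ ->].
exact: fNG.
Qed.
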